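(* Let $G$ be a finite group. (1) If $p_1<p_2$ are the two smallest prime divisors of $|G|$ and $\mathrm{pr}^*(G)>(p_1+p_2-1)/(p_1p_2)$, then $G$ is nilpotent. In particular, if $\mathrm{pr}^*(G)>2/3$, then $G$ is nilpotent. (2) If $\mathrm{pr}^*(G)>2/5$, then $G$ is soluble.
   Context: For subsets $X,Y$ of a finite group $G$, $\Pr(X,Y)=|\{(x,y)\in X\times Y: xy=yx\}|/(|X||Y|)$. For sets of primes $\pi_1,\pi_2$, $\mathrm{pr}^*_G(\pi_1,\pi_2)$ denotes the maximum real number $\epsilon$ such that for every pair of distinct primes $p\in\pi_1$, $q\in\pi_2$ there exist a Sylow $p$-subgroup $P$ and a Sylow $q$-subgroup $Q$ of $G$ with $\Pr(P,Q)\ge\epsilon$ (the Sylow $p$-subgroup is taken to be trivial if $p\nmid |G|$). $\mathrm{pr}^*(G)$ denotes $\mathrm{pr}^*_G(\pi,\pi)$ for any set of primes $\pi$ containing all prime divisors of $|G|$. *)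

(* Defs.v *)
From mathcomp Require Import all_boot all_order all_algebra all_fingroup all_solvable.
Set Implicit Arguments. Unset Strict Implicit. Unset Printing Implicit Defensive.
Import Order.TTheory GRing.Theory Num.Theory.
Local Open Scope ring_scope.

Definition commPr (gT : finGroupType) (X Y : {set gT}) : rat :=
  (#|[set xy in setX X Y | (xy.1 * xy.2 == xy.2 * xy.1)%g]|)%:R
  / (#|X| * #|Y|)%:R.

(* pr_star_ok G eps : eps satisfies the defining condition of pr*(G), i.e.
   for every pair of distinct primes p, q there exist P in Syl_p(G) and
   Q in Syl_q(G) with Pr(P,Q) >= eps.  (In mathcomp, ('Syl_p(G))%g = {1} when
   p does not divide |G|, matching the paper's convention.)
   pr*(G) is the maximum of such eps. *)
Definition pr_star_ok (gT : finGroupType) (G : {group gT}) (eps : rat) : Prop :=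
  forall p q : nat, prime p -> prime q -> p != q ->
    exists2 P : {group gT}, P \in ('Syl_p(G))%g &
    exists2 Q : {group gT}, Q \in ('Syl_q(G))%g & eps <= commPr P Q.

(* pr*(G) > c  (pr*(G) being the maximum admissible eps, this holds iff
   some admissible eps exceeds c). *)
Definition pr_star_gt (gT : finGroupType) (G : {group gT}) (c : rat) : Prop :=
  exists2 eps : rat, c < eps & pr_star_ok G eps.

(* Main.v *)
(** Pr(P, Q) is the average over x in P of |C_Q(x)| / |Q|.  If Q is a q-group,
this ratio is 1 for x in C_P(Q) and at most 1/q otherwise, so
Pr(P, Q) <= (q - 1 + i) / (q i) with i = |P : C_P(Q)|.

For non-commuting Sylow subgroups i >= p, so the hypotheses of (1) force Sylow
subgroups for distinct primes to commute, up to conjugation; every Sylow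
subgroup is then normal.

For (2), Pr(P, Q) > 2/5 and q >= 5 give i < 4, whence the q'-part of
|G : C_G(Q)| divides 6 for every Sylow q-subgroup Q with q >= 5.  This passes to
quotients, so one may assume O_q(G) = 1 for all q >= 5.  The number of Sylow
q-subgroups divides 6, is 1 mod q, and is not 1, so q = 5 and the number is 6.
Then G modulo the core of N_G(Q) embeds in S_6 while the core is a 5'-group,
so |Q| = 5; moreover N_G(Q) = C_G(Q), and Burnside's transfer theorem yields a
normal 5-complement, which is a {2, 3}-group, solvable by the p^a q^b theorem. *)

Require Import Defs.
From mathcomp Require Import all_boot all_order all_algebra all_fingroup all_solvable.
From mathcomp Require Import integral_char zify.
Set Implicit Arguments.
Unset Strict Implicit.
Unset Printing Implicit Defensive.
Import Order.TTheory GRing.Theory Num.Theory.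

(** * Coset actions, fusion in an abelian Sylow subgroup, and Burnside's transfer theorem *)

Section Transfer.
Local Open Scope group_scope.

(** The action of G on the right cosets of H has the core as its kernel, so the quotient embeds in a
    symmetric group of degree |G : H|. *)
Lemma index_gcore_dvd_fact (gT : finGroupType) (G H : {group gT}) :
  #|G : gcore H G| %| (#|G : H|)`!.
Proof.
pose S := rcosets H G.
have nSG : [acts G, on S | 'Rs] := actsRs_rcosets H G.
pose f := actperm <[nSG]>.
have kerf : 'ker f = G :&: gcore H G.
  by rewrite ker_actperm astab_actby setIT -astabRs_rcosets.
have sfS : f @* G \subset perm.Sym S.
  apply/subsetP=> _ /morphimP[a _ Ga ->]; rewrite inE.
  apply/subsetP=> A; rewrite inE; apply: contraR => nSA.
  by rewrite actpermE /= /actby (negbTE nSA).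
have := cardSg sfS; rewrite perm.card_Sym card_morphim /= setIid -/S.
by rewrite [X in #|_ : X|]kerf indexgI.
Qed.

(** As P is abelian, P and [P :^ g] are both Sylow subgroups of the centraliser of [x ^ g]. An
    element c of it conjugates the second to the first, and [g * c] is the required n. *)
Lemma abelian_Sylow_fusion (gT : finGroupType) (p : nat) (G P : {group gT})
    (x g : gT) :
    p.-Sylow(G) P -> abelian P -> x \in P -> g \in G -> x ^ g \in P ->
  exists2 n, n \in 'N_G(P) & x ^ g = x ^ n.
Proof.
move=> sylP abP Px Gg Pxg; have sPG := pHall_sub sylP.
have cP y : y \in P -> P \subset 'C_G[y].
  by move=> Py; rewrite subsetI sPG sub_cent1 (subsetP abP).
have sCG : 'C_G[x ^ g] \subset G := subsetIl _ _.
have sylPC := pHall_subl (cP _ Pxg) sCG sylP.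
have sylPgC : p.-Sylow('C_G[x ^ g]) (P :^ g).
  apply: (pHall_subl _ sCG); last by rewrite pHallJ.
  have defC : 'C_G[x ^ g] = 'C_G[x] :^ g.
    by rewrite conjIg (conjGid Gg) -normJ conjg_set1.
  rewrite /= defC.
  by rewrite conjSg cP.
have [c /setIP[Gc /cent1P cxc] defP] := Sylow_trans sylPgC sylPC.
exists (g * c); last by rewrite conjgM; apply/esym/conjg_fixP/commgP.
by rewrite inE groupM //= inE conjsgM -defP.
Qed.

(* By fusion control, every factor of the transfer of y in P is a power of y
   itself, hence the transfer acts on P as y |-> y ^+ #|G : P|. *)
Theorem Burnside_normal_complement (gT : finGroupType) (p : nat)
    (G P : {group gT}) :
  p.-Sylow(G) P -> 'N_G(P) \subset 'C(P) -> p^'.-Hall(G) 'O_p^'(G).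
Proof.
move=> sylP cNP; have sPG := pHall_sub sylP.
have abP : abelian P by apply: subset_trans cNP; rewrite subsetI sPG normG.
have abI : abelian (idm P @* P) by rewrite morphim_idm.
pose V := transfer_morphism G abI.
have VP y : y \in P -> y \in 'ker V -> y = 1.
  move=> Py /kerP; have Gy := subsetP sPG y Py.
  move=> /(_ Gy) /=.
  have trX := transversalP (rcosets_cycle_partition sPG Gy).
  rewrite (transfer_cycle_expansion sPG abI Gy trX).
  set X := transversal _ _; pose n x := #|<[y]> : P :* x|.
  have sXG := transversal_sub trX.
  rewrite (eq_bigr (fun x => FiniteModule.fmod abI (y ^+ n x))); last first.
    move=> x Xx; rewrite /restrm /=; congr (FiniteModule.fmod _ _).
    have Gx := subsetP sXG x Xx.
    have Pyx : (y ^+ n x) ^ x^-1 \in P.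
      rewrite conjgE invgK mulgA -mem_rcoset.
      exact: mulg_exp_card_rcosets.
    have [m Nm ->] := abelian_Sylow_fusion sylP abP (groupX (n x) Py)
      (groupVr Gx) Pyx.
    rewrite /conjg; have /centP cm := subsetP cNP m Nm.
    by rewrite -(cm (y ^+ n x)) ?groupX // mulKg.
  have Iy : y \in idm P @* P by rewrite morphim_idm.
  rewrite (eq_bigr (fun x => FiniteModule.fmod abI y *+ n x)%R); last first.
    by move=> x _; rewrite FiniteModule.fmodX.
  rewrite sumrMnr (sum_index_rcosets_cycle sPG Gy trX) -FiniteModule.fmodX //.
  move/(congr1 val); rewrite /= FiniteModule.fmodK ?groupX //= => y1.
  (* The order of y divides both |P| and |G : P|, which are coprime. *)
  apply/eqP; rewrite -order_eq1 -dvdn1.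
  have /eqP <- : coprime #|P| #|G : P|.
    by have /andP[] := pHall_Hall sylP.
  by rewrite dvdn_gcd order_dvdG // order_dvdn y1 eqxx.
(* The kernel meets P trivially, so it is a p'-group; its index is a power of p because V takes
   values in a copy of P. *)
have nKG : 'ker V <| G := ker_normal V.
have p'K : p^'.-group ('ker V).
  have sylK := Sylow_setI_normal nKG sylP.
  rewrite -partG_eq1 -(card_Hall sylK) -trivg_card1; apply/eqP/trivgP.
  by apply/subsetP=> y /setIP[Ky Py]; rewrite inE (VP y).
have pGK : p.-nat #|G : 'ker V|.
  have <- : #|V @* G| = #|G : 'ker V| by rewrite card_morphim setIid.
  apply: pnat_dvd (pHall_pgroup sylP).
  have injv : 'injm (FiniteModule.fmval_morphism abI).
    by apply/injmP=> u v _ _; apply: FiniteModule.fmod_inj.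
  rewrite -(card_injm injv (subsetT _)) cardSg //.
  apply/subsetP=> _ /morphimP[u _ _ ->].
  by have := FiniteModule.fmodP u; rewrite /= morphim_idm.
have hallK : p^'.-Hall(G) ('ker V).
  by rewrite /pHall normal_sub //= pnatNK; apply/andP.
by rewrite (normal_Hall_pcore hallK nKG).
Qed.
End Transfer.

(** * Counting commuting pairs *)

Section CommutingPairs.
Local Open Scope group_scope.
Variables (gT : finGroupType) (q : nat).
Hypothesis q_pr : prime q.

(** A proper subgroup of a q-group has index at least q. The boolean, read as 0 or 1, merges the
    central and non-central cases into one bound that can be summed over x. *)
Lemma card_subcent1_le (Q : {group gT}) (x : gT) : q.-group Q ->
  (q * #|'C_Q[x]| <= #|Q| + (x \in 'C(Q)) * (q.-1 * #|Q|))%N.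
Proof.
move=> qQ; have q_gt0 := prime_gt0 q_pr.
case: (boolP (x \in 'C(Q))) => [cQx | not_cQx].
  by rewrite mul1n -mulSn prednK // leq_mul2l subset_leq_card ?subsetIl ?orbT.
rewrite mul0n addn0 -(Lagrange (subsetIl Q 'C[x])) mulnC leq_pmul2l //.
have: 1 < #|Q : 'C_Q[x]|.
  by rewrite indexg_gt1 subsetI subxx sub_cent1.
have: q.-nat #|Q : 'C_Q[x]| := pnat_dvd (dvdn_indexg _ _) qQ.
case/p_natP=> [[|k]] -> //; rewrite expnS => _.
by rewrite leq_pmulr // expn_gt0 q_gt0.
Qed.

Lemma card_commuting_pairs (P Q : {group gT}) :
  #|[set xy in setX P Q | xy.1 * xy.2 == xy.2 * xy.1]|
    = (\sum_(x in P) #|'C_Q[x]|)%N.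
Proof.
rewrite -sum1_card; under [RHS]eq_bigr do rewrite -sum1_card.
rewrite pair_big_dep /=; apply: eq_bigl => -[x y].
by rewrite [LHS]inE in_setX in_setI cent1E -andbA [_ == _ in RHS]eq_sym.
Qed.

Lemma card_commuting_pairs_le (P Q : {group gT}) : q.-group Q ->
  (q * #|[set xy in setX P Q | (xy.1 * xy.2 == xy.2 * xy.1)%g]|
    <= #|Q| * (q.-1 * #|'C_P(Q)| + #|P|))%N.
Proof.
move=> qQ; rewrite card_commuting_pairs big_distrr /=.
apply: leq_trans (leq_sum _ (fun x _ => card_subcent1_le x qQ)) _.
rewrite big_split /= sum_nat_const -big_distrl /=.
have -> : (\sum_(x in P) (x \in 'C(Q)) = #|'C_P(Q)|)%N.
  rewrite -sum1_card [RHS]big_mkcond [LHS]big_mkcond /=.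
  by apply: eq_bigr => x _; rewrite inE; case: (x \in P); case: (x \in 'C(Q)).
by rewrite mulnDr addnC (mulnC #|P|) mulnCA [(_ * #|Q|)%N]mulnC mulnCA.
Qed.

(** This is a/b < (q - 1 + i)/(q i) with denominators cleared, so that later estimates stay in
    natural numbers. *)
Lemma commPr_gt (P Q : {group gT}) (a b : nat)
    (i := #|P : 'C_P(Q)|) : q.-group Q -> (0 < b)%N ->
  (a%:R / b%:R < commPr P Q)%R -> (a * (q * i) < b * (q.-1 + i))%N.
Proof.
move=> qQ b_gt0; have := card_commuting_pairs_le P qQ.
rewrite /commPr; set n := #|_| => le_n.
have PQ_gt0 : (0 < #|P| * #|Q|)%N by rewrite muln_gt0 !cardG_gt0.
rewrite ltr_pdivrMr ?ltr0n // mulrAC ltr_pdivlMr ?ltr0n //.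
rewrite -!natrM ltr_nat => lt_n.
move: le_n lt_n PQ_gt0; rewrite -(Lagrange (subsetIl P 'C(Q))) -/i.
have := prime_gt0 q_pr.
move: #|Q| #|'C_P(Q)| => m c q_gt0 le_n lt_n.
rewrite !muln_gt0 => /andP[/andP[c_gt0 _] m_gt0].
(* The common factor is |C_P(Q)| |Q|; the comparison goes through [b * (q * n)], with n the number
   of commuting pairs. *)
have lt_cm : (c * m * (a * (q * i)) < c * m * (b * (q.-1 + i)))%N.
  apply: (@leq_trans (b * (q * n))); last first.
    by have := leq_mul (leqnn b) le_n; nia.
  rewrite (mulnCA b q n) [X in (X < _)%N](_ : _ = q * (a * (c * i * m)))%N.
    by rewrite ltn_pmul2l //; nia.
  by nia.
by rewrite ltn_pmul2l ?muln_gt0 ?c_gt0 // in lt_cm.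
Qed.

End CommutingPairs.

(** * Nilpotency from commuting Sylow subgroups *)

Section Nilpotent.
Local Open Scope group_scope.

Lemma Sylow_trivg (gT : finGroupType) (p : nat) (G P : {group gT}) :
  p.-Sylow(G) P -> ~~ (p %| #|G|) -> P :=: 1.
Proof.
move=> sylP p'G; apply/eqP; rewrite trivg_card1 (card_Hall sylP).
by rewrite p_part_eq1 mem_primes (negbTE p'G) !andbF.
Qed.

(** No prime q divides |G : N_G(P)|: for q = p because P lies in its normaliser, otherwise because a
    Sylow q-subgroup centralises a conjugate of P. So all Sylow subgroups are normal and lie in the
    Fitting subgroup. *)
Lemma nilpotent_commuting_Sylows (gT : finGroupType) (G : {group gT}) :
    (forall p q : nat, prime p -> prime q -> p != q ->
      exists2 P : {group gT}, p.-Sylow(G) P &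
      exists2 Q : {group gT}, q.-Sylow(G) Q & P \subset 'C(Q)) ->
  nilpotent G.
Proof.
move=> comS; suff sGF : G \subset 'F(G).
  exact: nilpotentS sGF (Fitting_nil G).
suff: #|G| %| #|'F(G)|.
  move/dvdn_leq => /(_ (cardG_gt0 _)) leGF.
  by have /eqP -> : 'F(G) == G by rewrite eqEcard Fitting_sub.
apply/dvdn_partP=> // p; rewrite mem_primes => /and3P[p_pr _ _].
have [P sylP] := Sylow_exists p G; rewrite -(card_Hall sylP).
apply/cardSg/Fitting_max; last exact: pgroup_nil (pHall_pgroup sylP).
rewrite /normal (pHall_sub sylP).
suff: #|G : 'N_G(P)| == 1%N by rewrite indexg_eq1 subsetI => /andP[].
have [//|i_gt1] := eqVneq; have := pdiv_prime (n := #|G : 'N_G(P)|).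
rewrite ltn_neqAle eq_sym i_gt1 indexg_gt0 => /(_ isT).
set q := pdiv _ => q_pr; have q_dv : q %| #|G : 'N_G(P)| := pdiv_dvd _.
have [eq_qp | neq_pq] := eqVneq p q.
  have /and3P[sPG _ p'i] := sylP.
  have: q %| #|G : P|.
    by apply: dvdn_trans q_dv (indexgS _ _); rewrite subsetI sPG normG.
  move/(pnatP _ (indexg_gt0 _ _)): p'i => /(_ _ q_pr) p'q /p'q.
  by rewrite !inE eq_qp eqxx.
have [P1 sylP1 [Q sylQ cPQ]] := comS _ _ p_pr q_pr neq_pq.
have: q %| #|G : Q|.
  (* Both normaliser indices count the Sylow p-subgroups, so P may be replaced by P1. *)
  rewrite -(card_Syl sylP) (card_Syl sylP1) in q_dv.
  apply: dvdn_trans q_dv (indexgS _ _); rewrite subsetI (pHall_sub sylQ).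
  by rewrite cents_norm // centsC.
have /and3P[_ _ q'i] := sylQ.
move/(pnatP _ (indexg_gt0 _ _)): q'i => /(_ _ q_pr) q'q /q'q.
by rewrite !inE eqxx.
Qed.

(** The bound equals 1 - (1 - 1/i)(1 - 1/q), which decreases in i and in q. Without commutation i >=
    p >= r and q >= s, so it would be at most its value at (r, s). *)
Lemma commPr_gt_cents (gT : finGroupType) (p q r s : nat) (P Q : {group gT}) :
    prime p -> prime q -> p.-group P -> q.-group Q ->
    (0 < r <= p)%N -> (0 < s <= q)%N ->
    ((r + s - 1)%N%:R / (r * s)%N%:R < commPr P Q)%R ->
  P \subset 'C(Q).
Proof.
move=> p_pr q_pr pP qQ /andP[r0 le_rp] /andP[s0 le_sq] /(commPr_gt q_pr qQ).
rewrite muln_gt0 r0 s0 => /(_ isT).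
have: p.-nat #|P : 'C_P(Q)| := pnat_dvd (dvdn_indexg _ _) pP.
case/p_natP=> [[|k]] ik.
  by move/eqP: ik; rewrite indexg_eq1 subsetI => /andP[].
have: (p <= #|P : 'C_P(Q)|)%N.
  by rewrite ik expnS leq_pmulr // expn_gt0 prime_gt0.
move: #|_ : _| => i le_pi.
(* In the excesses u, v and the predecessors of r, s, the difference of the two sides is a
   polynomial with nonnegative coefficients. *)
have [u ->] : exists u, i = (r + u)%N by exists (i - r)%N; lia.
have [v ->] : exists v, q = (s + v)%N by exists (q - s)%N; lia.
case: r r0 {le_rp} => // r _; case: s s0 {le_sq} => // s _.
nia.
Qed.

End Nilpotent.

(** * Solubility from centraliser indices of Sylow subgroups *)

Section Solvable.
Local Open Scope group_scope.

(** |C_P(Q)| divides the p-part of |C_G(Q)|, while |P| is the p-part of |G|. This carries bounds on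
    i over to the index in G. *)
Lemma index_subcent_part (gT : finGroupType) (p : nat) (G P Q : {group gT}) :
  p.-Sylow(G) P -> #|G : 'C_G(Q)|`_p %| #|P : 'C_P(Q)|.
Proof.
move=> sylP; have sPG := pHall_sub sylP.
have pC : p.-group 'C_P(Q) := pgroupS (subsetIl _ _) (pHall_pgroup sylP).
have /dvdnP[m def_m] : #|'C_P(Q)| %| #|'C_G(Q)|`_p.
  by rewrite -(part_pnat_id pC) partn_dvd // cardSg // setSI.
apply/dvdnP; exists m.
have := card_Hall sylP; rewrite -(Lagrange (subsetIl P 'C(Q))).
rewrite -(Lagrange (subsetIl G 'C(Q))) partnM // def_m.
by rewrite (mulnC m) -mulnA => /eqP; rewrite eqn_pmul2l // => /eqP.
Qed.

Lemma index_subcentJ (gT : finGroupType) (G Q : {group gT}) (x : gT) :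
  x \in G -> #|G : 'C_G(Q :^ x)| = #|G : 'C_G(Q)|.
Proof.
by move=> Gx; rewrite -{1 2}(conjGid Gx) centJ -conjIg indexJg.
Qed.

(** The consequence of pr*(G) > 2/5 on which the induction on |G| runs, since it is inherited by
    quotients. *)
Definition Sylow_cent_index_dvd6 (gT : finGroupType) (G : {group gT}) : Prop :=
  forall q : nat, prime q -> (4 < q)%N ->
    exists2 Q : {group gT}, q.-Sylow(G) Q & #|G : 'C_G(Q)|`_q^' %| 6.

Lemma pr_star_gt_cent_index (gT : finGroupType) (G : {group gT}) :
  pr_star_gt G (2%:R / 5%:R)%R -> Sylow_cent_index_dvd6 G.
Proof.
case=> eps lt_eps okG q q_pr q_gt4.
have [Q sylQ] := Sylow_exists q G; exists Q => //.
(* Divisibility is tested one prime r at a time, with the Sylow pair supplied for r and q; conjugacy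
   relates its q-member to Q. *)
apply/dvdn_partP=> [|r]; first exact: part_gt0.
rewrite pi_of_part // inE /= => /andP[/[!mem_primes] /and3P[r_pr _ _] q'r].
have neq_rq : r != q by rewrite !inE in q'r.
have [P sylP [Q1 sylQ1 le_eps]] := okG _ _ r_pr q_pr neq_rq.
rewrite !inE in sylP sylQ1.
have := commPr_gt q_pr (pHall_pgroup sylQ1) (isT : 0 < 5)%N
  (lt_le_trans lt_eps le_eps).
have i_gt0 := indexg_gt0 P 'C_P(Q1).
have dvd_i : #|G : 'C_G(Q)|`_q^'`_r %| #|P : 'C_P(Q1)|.
  have [x Gx defQ1] := Sylow_trans sylQ sylQ1.
  apply: dvdn_trans (index_subcent_part Q1 sylP).
  by rewrite defQ1 index_subcentJ // partn_dvd // dvdn_part.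
move=> lt_i; apply: dvdn_trans dvd_i _.
(* From 2qi < 5(q - 1 + i) one gets i < 5(q - 1)/(2q - 5), which is at most 4 for q >= 5. *)
have: (#|P : 'C_P(Q1)| < 4)%N by nia.
by case: #|_ : _| i_gt0 => [|[|[|[]]]].
Qed.

(** The image of C_G(Q) centralises Q / N, so the index in the quotient divides the original one. *)
Lemma Sylow_cent_index_quotient (gT : finGroupType) (G N : {group gT}) :
  N <| G -> Sylow_cent_index_dvd6 G -> Sylow_cent_index_dvd6 (G / N).
Proof.
move=> /andP[_ nNG] GP q q_pr q_gt4; have [Q sylQ dvd6] := GP q q_pr q_gt4.
have nNQ := subset_trans (pHall_sub sylQ) nNG.
exists (Q / N)%G; first exact: quotient_pHall.
apply: dvdn_trans dvd6; apply: partn_dvd => //.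
apply: dvdn_trans (index_quotient _).
  exact/indexgS/quotient_subcent.
exact: subset_trans (subsetIl _ _) nNG.
Qed.

Lemma solvable_23group (gT : finGroupType) (G : {group gT}) :
  (forall p, prime p -> p %| #|G| -> p < 5)%N -> solvable G.
Proof.
move=> le_p; apply: Burnside_p_a_q_b.
apply: (@uniq_leq_size _ _ [:: 2; 3]) (primes_uniq _) _ => p.
rewrite mem_primes => /and3P[p_pr _ /(le_p p p_pr)].
by case: p p_pr => [|[|[|[|[|]]]]].
Qed.

Lemma solvable_Sylow_cent_index (gT : finGroupType) (G : {group gT}) :
  Sylow_cent_index_dvd6 G -> solvable G.
Proof.
have [n] := ubnP #|G|; elim: n => // n IHn in gT G *; rewrite ltnS => leGn GP.
have [/hasP[q _ /andP[q_gt4 ntOq]] | /hasPn tiO] :=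
    boolP (has (fun q => (4 < q) && ('O_q(G) != 1)) (primes #|G|)).
  rewrite (series_sol (pcore_normal q G)).
  rewrite (pgroup_sol (pcore_pgroup q G)) IHn //.
    by apply: leq_trans leGn; rewrite ltn_quotient ?pcore_sub.
  exact: Sylow_cent_index_quotient (pcore_normal _ _) GP.
have nSyl q (Q : {group gT}) :
    prime q -> (4 < q)%N -> q %| #|G| -> q.-Sylow(G) Q ->
  #|G : 'C_G(Q)|`_q^' %| 6 -> q = 5 /\ #|G : 'N_G(Q)| = 6.
  move=> q_pr q_gt4 qG sylQ dvd6.
  have [sQG qQ q'i] := and3P sylQ.
  have sQN : Q \subset 'N_G(Q) by rewrite subsetI sQG normG.
  have q'N : q^'.-nat #|G : 'N_G(Q)| := pnat_dvd (indexgS _ sQN) q'i.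
  have dvdN : #|G : 'N_G(Q)| %| 6.
    apply: dvdn_trans dvd6; rewrite -(part_pnat_id q'N) partn_dvd //.
    by rewrite indexgS // setIS ?cent_sub.
  have modN : #|G : 'N_G(Q)| = 1 %[mod q].
    by rewrite -(card_Syl sylQ) card_Syl_mod // modn_small // prime_gt1.
  have Nn1 : #|G : 'N_G(Q)| != 1%N.
    rewrite indexg_eq1 subsetI subxx /=; apply/negP=> nQG.
    have /(tiO q) : q \in primes #|G| by rewrite mem_primes q_pr cardG_gt0.
    rewrite q_gt4 /= negbK => /eqP Oq1.
    have := normal_Hall_pcore sylQ (introT andP (conj sQG nQG)).
    rewrite Oq1 => Q1; have := card_Hall sylQ; rewrite -Q1 cards1.
    by move/eqP; rewrite eq_sym p_part_eq1 mem_primes q_pr cardG_gt0 qG.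
  have := dvdn_leq (isT : 0 < 6)%N dvdN.
  move: modN dvdN Nn1; rewrite (modn_small (_ : 1 < q)) ?prime_gt1 //.
  move: #|_ : _| => m modN dvdN Nn1 le_m6.
  (* If m < q, the congruence gives m = 1; otherwise m > 4, and 6 is the only such divisor of 6. *)
  have m6 : m = 6.
    have [lt_mq | le_qm] := ltnP m q.
      by rewrite modn_small // in modN; rewrite modN in Nn1.
    have: (4 < m)%N := leq_trans q_gt4 le_qm.
    by case: m {modN Nn1 le_qm} dvdN le_m6 => [|[|[|[|[|[|[|m]]]]]]].
  split=> //; rewrite m6 in modN; move: modN q_gt4 => {sylQ dvd6 qG qQ q'i q'N}.
  by case: q q_pr => [|[|[|[|[|[|[|q]]]]]]].
have le5 q : prime q -> q %| #|G| -> (4 < q)%N -> q = 5.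
  move=> q_pr qG q_gt4; have [Q sylQ dvd6] := GP q q_pr q_gt4.
  by have [] := nSyl q Q q_pr q_gt4 qG sylQ dvd6.
have [G5 | G5] := boolP (5 %| #|G|); last first.
  apply: solvable_23group => p p_pr pG; rewrite ltnNge; apply/negP=> p_gt4.
  by rewrite -(le5 p) ?pG in G5.
have [Q sylQ dvd6] := GP 5 isT isT.
have [_ N6] := nSyl 5 Q isT isT G5 sylQ dvd6.
have [sQG qQ q'i] := and3P sylQ.
have O5_1 : 'O_5(G) = 1.
  by apply/eqP; have := tiO 5; rewrite mem_primes cardG_gt0 G5 negbK; apply.
pose K := gcore_group 'N_G(Q) G.
have nKG : K <| G := gcore_normal (subsetIl G 'N(Q)).
have sKN : K \subset 'N_G(Q) := gcore_sub _ _.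
(* K normalises Q, so its Sylow subgroup [K :&: Q] is normal in K, hence equals O_5(K), which lies
   in O_5(G) = 1. *)
have K5 : (#|K|`_5 = 1)%N.
  have sylKQ := Sylow_setI_normal nKG sylQ.
  rewrite -(card_Hall sylKQ); apply/eqP; rewrite -trivg_card1 -subG1 -O5_1.
  have nKQ : K :&: Q <| K.
    rewrite /normal subsetIl normsI ?normG //.
    exact: subset_trans sKN (subsetIr _ _).
  rewrite -(normal_Hall_pcore sylKQ nKQ) pcore_max ?pcore_pgroup //.
  by rewrite gFnormal_trans.
(* |G : K| divides 6!, whose 5-part is 5. *)
have Q5 : #|Q| %| 5.
  rewrite (card_Hall sylQ) -(Lagrange (normal_sub nKG)) partnM // K5 mul1n.
  have := index_gcore_dvd_fact G 'N_G(Q)%G; rewrite N6 => dvd_fact.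
  apply: dvdn_trans (partn_dvd 5 (fact_gt0 6) dvd_fact) _.
  by rewrite p_part logn_fact // unlock.
have abQ : abelian Q by rewrite cyclic_abelian // (dvdn_prime_cyclic _ Q5).
have sQC : Q \subset 'C_G(Q) by rewrite subsetI sQG.
have sCN : 'C_G(Q) \subset 'N_G(Q) by rewrite setIS ?cent_sub.
(* As Q is abelian, |G : C_G(Q)| is prime to 5, so all of it divides 6 = |G : N_G(Q)|, and the two
   subgroups coincide. *)
have cNQ : 'N_G(Q) \subset 'C(Q).
  have iC : 5^'.-nat #|G : 'C_G(Q)| := pnat_dvd (indexgS _ sQC) q'i.
  move: dvd6; rewrite (part_pnat_id iC) -(Lagrange_index (subsetIl G 'N(Q)) sCN).
  rewrite N6 -[X in _ %| X]muln1 dvdn_pmul2l // dvdn1 indexg_eq1.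
  by rewrite subsetI => /andP[].
have hallO := Burnside_normal_complement sylQ cNQ.
rewrite (series_sol (pcore_normal 5^' G)); apply/andP; split.
  apply: solvable_23group => p p_pr pO; rewrite ltnNge; apply/negP=> p_gt4.
  have p5 : p = 5.
    by apply: le5 => //; apply: dvdn_trans pO (cardSg (pcore_sub _ _)).
  have := pcore_pgroup 5^' G; move/pgroupP => /(_ _ p_pr pO).
  by rewrite p5.
apply: (@pgroup_sol _ 5); rewrite /pgroup card_quotient ?gFnorm //.
by have /and3P[_ _] := hallO; rewrite pnatNK.
Qed.
End Solvable.

(** * Choice of the thresholds *)

Local Open Scope ring_scope.

Theorem theorem1p3 (gT : finGroupType) (G : {group gT}) :
  [/\ (forall p1 p2 : nat,
         prime p1 -> prime p2 -> (p1 < p2)%N ->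
         (p1 %| #|G|)%N -> (p2 %| #|G|)%N ->
         (forall r : nat, prime r -> (r %| #|G|)%N -> (r < p2)%N -> r = p1) ->
         pr_star_gt G ((p1 + p2 - 1)%N%:R / (p1 * p2)%N%:R) ->
         nilpotent G),
      (pr_star_gt G (2%:R / 3%:R) -> nilpotent G)
    & (pr_star_gt G (2%:R / 5%:R) -> solvable G)].
Proof.
split=> [p1 p2 p1_pr p2_pr lt_p12 _ _ min_p [eps lt_eps okG]
        | [eps lt_eps okG] |].
- apply: nilpotent_commuting_Sylows => p q p_pr q_pr neq_pq.
  have [P sylP [Q sylQ le_eps]] := okG p q p_pr q_pr neq_pq.
  rewrite !inE in sylP sylQ; exists P => //; exists Q => //.
  have [pG | p'G] := boolP (p %| #|G|)%N; last first.
    by rewrite (Sylow_trivg sylP p'G) sub1G.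
  have [qG | q'G] := boolP (q %| #|G|)%N; last first.
    by rewrite (Sylow_trivg sylQ q'G) cent1T subsetT.
  have lt_Pr := lt_le_trans lt_eps le_eps.
  have [p1_gt0 p2_gt0] := (prime_gt0 p1_pr, prime_gt0 p2_pr).
  have [pP qQ] := (pHall_pgroup sylP, pHall_pgroup sylQ).
  have mp := min_p p p_pr pG; have mq := min_p q q_pr qG.
  (* The smaller of p and q is at least p1 and the larger at least p2; their order decides which
     bound goes with which. *)
  have [lt_pq | lt_qp] := leqP p q.
    by apply: (commPr_gt_cents p_pr q_pr pP qQ _ _ lt_Pr); lia.
  rewrite addnC mulnC in lt_Pr.
  by apply: (commPr_gt_cents p_pr q_pr pP qQ _ _ lt_Pr); lia.
- apply: nilpotent_commuting_Sylows => p q p_pr q_pr neq_pq.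
  have [P sylP [Q sylQ le_eps]] := okG p q p_pr q_pr neq_pq.
  rewrite !inE in sylP sylQ; exists P => //; exists Q => //.
  have lt_Pr := lt_le_trans lt_eps le_eps.
  have [pP qQ] := (pHall_pgroup sylP, pHall_pgroup sylQ).
  have [p_gt1 q_gt1] := (prime_gt1 p_pr, prime_gt1 q_pr).
  (* 2/3 is the threshold for the primes 2 and 3, which bound any two distinct primes from below. *)
  have E23 : 2%:R / 3%:R = (2 + 3 - 1)%N%:R / (2 * 3)%N%:R :> rat by [].
  have E32 : 2%:R / 3%:R = (3 + 2 - 1)%N%:R / (3 * 2)%N%:R :> rat by [].
  have [lt_pq | lt_qp] := leqP p q.
    rewrite E23 in lt_Pr.
    by apply: (commPr_gt_cents p_pr q_pr pP qQ _ _ lt_Pr); lia.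
  rewrite E32 in lt_Pr.
  by apply: (commPr_gt_cents p_pr q_pr pP qQ _ _ lt_Pr); lia.
by move=> /pr_star_gt_cent_index/solvable_Sylow_cent_index.
Qed.
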